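(* Let $F_1,F_2$ be the cumulative distribution functions of $\mu_1,\mu_2\in\mathcal{D}_{\mathrm{co}}$, respectively. If there exists $x_0>0$ such that $F_1(x_0)>F_2(x_0)$ and such that $F_1(x)\ge F_2(x)$ for all $x\ge x_0$, then $\mu_1\preceq\mu_2$ (notice that the order is reversed).
   Context: $\mathbb{N}$ is the set of natural numbers including $0$. $\mathcal{D}_{\mathrm{co}}$ is the set of finite positive Borel measures $\mu$ on $[0,\infty)$ for which there exist $0<a<b<\infty$ with $\operatorname{supp}\mu\subset[a,b]$; all moments of such measures exist. The cumulative distribution function of $\mu$ is $F(x)=\mu([0,x])$. The moments are $s_n(\mu)=\int_0^\infty t^n\,d\mu(t)$, $n\in\mathbb{N}$. The tail relation is defined by: $\mu_1\preceq\mu_2$ if and only if there is $n_0\in\mathbb{N}$ such that $s_n(\mu_1)\le s_n(\mu_2)$ for all $n\ge n_0$.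
   Formalization: The measures are additionally assumed to have equal total mass; without this the claim fails, e.g. for μ1 = 2δ_1, μ2 = δ_1, x0 = 1, where F1 > F2 on [1,∞) but s_n(μ1) = 2 > 1 = s_n(μ2) for all n. *)

(* Defs.v *)
From mathcomp Require Import all_boot all_order all_algebra.
From mathcomp Require Import all_classical all_reals all_analysis.

Set Implicit Arguments.
Unset Strict Implicit.
Unset Printing Implicit Defensive.

Import Order.TTheory GRing.Theory Num.Theory.
Import numFieldNormedType.Exports.

Local Open Scope classical_set_scope.
Local Open Scope ring_scope.
Local Open Scope ereal_scope.

(* A finite positive Borel measure on [0, +oo) is represented by its extension
   by zero to the Borel sets of R. *)
Notation finite_borel_measure R :=
  {finite_measure set (measurableTypeR R) -> \bar R}.

Section tail_order.
Context {R : realType}.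
Implicit Types mu : finite_borel_measure R.

Definition msupp mu : set R :=
  [set x : R | forall U : set R, open_nbhs x U -> 0 < mu U].

(* The first conjunct says that mu lives on [0, +oo), see above. *)
Definition Dco mu : Prop :=
  mu [set` `]-oo, 0%R[] = 0 /\
  exists a b : R, [/\ (0 < a)%R, (a < b)%R & msupp mu `<=` `[a, b]].

Definition cdfm mu (x : R) : \bar R := mu [set` `[0%R, x]].

Definition smoment mu (n : nat) : \bar R :=
  \int[mu]_(t in `[0%R, +oo[) (t ^+ n)%:E.

Definition tail_le mu1 mu2 : Prop :=
  exists n0 : nat, forall n : nat, (n0 <= n)%N -> smoment mu1 n <= smoment mu2 n.

End tail_order.

(* Main.v *)
Require Import Defs.
From mathcomp Require Import all_boot all_order all_algebra.
From mathcomp Require Import all_classical all_reals all_analysis.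
From mathcomp Require Import measurable_realfun.
Import Order.TTheory GRing.Theory Num.Theory.
Import numFieldNormedType.Exports.
Local Open Scope classical_set_scope.
Local Open Scope ring_scope.
Local Open Scope ereal_scope.

(** Pass from distribution functions to the tails [G(x) = mu ]x, +oo[]. As both
    measures have the same mass and do not charge the negative reals, the
    hypothesis on the distribution functions becomes [G1 <= G2] on [[x0, +oo[]
    and [G1 x0 < G2 x0].  Since [G2] is right continuous, there are [x1 > x0]
    and [d > 0] with [G1 + d <= G2] on [[x0, x1[] ([survival_right_gap]).

    The layer cake formula ([layer_cake]) turns the [n]-th moment into the
    Lebesgue integral over [r >= 0] of [G (r ^ (1/n))].  With [M] the common
    mass, the integrands satisfy pointwise
<<
      G1 + d * 1_[x0^n, x1^n[  <=  G2 + M * 1_[0, x0^n[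
>>
    and integrating gives ([smoment_gap])
<<
      s_n(mu1) + d * (x1^n - x0^n)  <=  s_n(mu2) + M * x0^n.
>>
    Because [x1 > x0 > 0], the gain [d * (x1^n - x0^n)] exceeds the loss
    [M * x0^n] for all large [n] ([le_exprM_near]). *)

(** The rate at which the larger base wins: any constant factor is eventually
    absorbed, because the powers of [x / y] tend to zero. *)
Lemma le_exprM_near (R : archiRealFieldType) (c x y : R) :
  (0 < x)%R -> (x < y)%R -> (0 <= c)%R ->
  exists n0 : nat, forall n, (n0 <= n)%N -> (c * x ^+ n <= y ^+ n)%R.
Proof.
move=> x0 xy c0.
have y0 : (0 < y)%R by exact: lt_trans xy.
have q1 : (`|x / y| < 1)%R.
  by rewrite ger0_norm ?divr_ge0 ?ltW// ltr_pdivrMr// mul1r.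
have c1 : (0 < (c + 1)^-1)%R by rewrite invr_gt0 ltr_wpDl.
have [n0 _ hn0] := cvgr0_norm_lt _ (cvg_expr q1) _ c1.
exists n0 => n nn0; have := hn0 n nn0.
have xyn0 : (0 <= (x / y) ^+ n)%R by rewrite exprn_ge0// divr_ge0// ltW.
rewrite /= (ger0_norm xyn0) exprMn exprVn ltr_pdivrMr ?exprn_gt0//.
rewrite ltr_pdivlMl ?ltr_wpDl// => /ltW; apply: le_trans.
by rewrite ler_wpM2r ?lerDl// exprn_ge0// ltW.
Qed.

Lemma powR_invnXn (R : realType) (r : R) (n : nat) :
  (0 <= r)%R -> (0 < n)%N -> ((r `^ n%:R^-1) ^+ n)%R = r.
Proof.
move=> r0 n0; rewrite -powR_mulrn ?powR_ge0// -powRrM.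
by rewrite mulVf ?powRr1// pnatr_eq0 -lt0n.
Qed.

Lemma measurable_superlevel d (T : measurableType d) (R : realType)
    (f : T -> R) (r : R) : measurable_fun setT f ->
  measurable [set x | (r < f x)%R].
Proof.
move=> mf; rewrite -[X in measurable X]setTI.
have := measurable_fun_ltr (@measurable_cst _ _ _ _ setT r) mf.
move=> /(_ measurableT [set true]); exact.
Qed.

Lemma measurable_hypograph d (T : measurableType d) (R : realType)
    (f : T -> R) : measurable_fun setT f ->
  measurable [set p : T * measurableTypeR R | (p.2 < f p.1)%R].
Proof.
move=> mf; rewrite -[X in measurable X]setTI.
have mf1 : measurable_fun setT (fun p : T * measurableTypeR R => f p.1).
  exact: measurableT_comp.
have := measurable_fun_ltr (@measurable_snd _ _ T (measurableTypeR R)) mf1.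
move=> /(_ measurableT [set true]); exact.
Qed.

(** The superlevel sets of [f] are the sections of the region below its
    graph. *)
Lemma measurable_superlevel_measure d (T : measurableType d) (R : realType)
    (mu : {sigma_finite_measure set T -> \bar R}) (f : T -> R) :
  measurable_fun setT f ->
  measurable_fun [set: measurableTypeR R] (fun r => mu [set x | (r < f x)%R]).
Proof.
move=> mf; have := measurable_fun_ysection mu (measurable_hypograph _ _ _ _ mf).
rewrite (_ : _ \o _ = fun r => mu [set x | (r < f x)%R])//.
apply/funext => r /=; congr (mu _).
by apply/seteqP; split => x /=; rewrite /ysection/= inE.
Qed.

(** Both sides are the iterated integrals of the indicator of the region [B]
    between the zero axis and the graph of [f]. *)
Lemma layer_cake d (T : measurableType d) (R : realType)
    (mu : {sigma_finite_measure set T -> \bar R}) (f : T -> R) :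
  measurable_fun setT f -> (forall x, (0 <= f x)%R) ->
  \int[mu]_x (f x)%:E =
  \int[@lebesgue_measure R]_(r in `[0%R, +oo[) mu [set x | (r < f x)%R].
Proof.
move=> mf f0.
pose B := [set p : T * measurableTypeR R | (p.2 < f p.1)%R] `&`
          (snd @^-1` `[0%R, +oo[%classic).
have mB : measurable B.
  apply: measurableI; first exact: measurable_hypograph.
  rewrite -[X in measurable X]setTI; exact: measurable_snd.
transitivity (\int[mu]_x \int[@lebesgue_measure R]_r (\1_B (x, r))%:E).
  apply: eq_integral => x _.
  transitivity (\int[@lebesgue_measure R]_r (\1_(`[0%R, f x[%classic : set R) r)%:E).
    rewrite integral_indic//= setIT lebesgue_measure_itv/= lte_fin.
    case: ltP => fx; first by rewrite sube0.
    by congr _%:E; apply/le_anti; rewrite fx f0.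
  apply: eq_integral => r _; rewrite !indicE; congr ((_ : bool)%:R)%:E.
  apply/idP/idP; rewrite !inE /B/= !in_itv/= andbT; first by move=> /andP[].
  by move=> [-> ->].
rewrite (fubini_tonelli (m1 := mu) (m2 := @lebesgue_measure R)
  (fun p => (\1_B p)%:E))//=; last first.
  by apply/measurable_EFinP/measurable_indic.
rewrite [RHS]integral_mkcond; apply: eq_integral => r _.
rewrite patchE; case: ifPn => [|]; rewrite ?inE ?notin_setE/= in_itv/= andbT => r0.
  rewrite -[[set x | _]]setIT -integral_indic//; last exact: measurable_superlevel.
  apply: eq_integral => x _; rewrite !indicE; congr ((_ : bool)%:R)%:E.
  by apply/idP/idP; rewrite !inE /B/= in_itv/= andbT; [case|split].
apply: integral0_eq => x _; rewrite indicE memNset// => -[_ /=].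
by rewrite in_itv/= andbT.
Qed.

Lemma smoment_layer_cake (R : realType) (mu : finite_borel_measure R) n :
  (0 < n)%N ->
  smoment mu n =
  \int[@lebesgue_measure R]_(r in `[0%R, +oo[) mu `](r `^ n%:R^-1)%R, +oo[%classic.
Proof.
(* The positive part makes the integrand a nonnegative function on the whole
   line; for n > 0 its n-th power vanishes on the negative reals. *)
move=> n0; pose f (t : R) := (Num.max t 0 ^+ n)%R.
have mf : measurable_fun [set: measurableTypeR R] f.
  by apply: measurable_funX; exact: measurable_maxr.
have f0 t : (0 <= f t)%R by rewrite exprn_ge0// le_max lexx orbT.
transitivity (\int[mu]_t (f t)%:E).
  rewrite /smoment integral_mkcond; apply: eq_integral => t _.
  rewrite patchE /f; case: ifPn; rewrite ?inE ?notin_setE/= in_itv/= andbT.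
    by move=> t0; rewrite max_l.
  by move/negP; rewrite -ltNge => /ltW t0; rewrite max_r// expr0n; case: n n0 {mf f f0}.
rewrite (layer_cake _ _ _ mu)//; apply: eq_integral => r.
rewrite inE/= in_itv/= andbT => r0; congr (mu _).
have rE := powR_invnXn _ _ _ r0 n0.
have fE t : (r < f t)%R = (r `^ n%:R^-1 < t)%R.
  rewrite -[in LHS]rE /f ltr_pXn2r// ?nnegrE ?powR_ge0 ?le_max ?lexx ?orbT//.
  by rewrite lt_max [X in _ || X]ltNge powR_ge0 orbF.
by apply/seteqP; split => t /=; rewrite in_itv/= andbT fE.
Qed.

Lemma survivalE (R : realType) (mu : finite_borel_measure R) (x : R) :
  mu [set` `]-oo, 0%R[] = 0 -> (0 <= x)%R ->
  mu `]x, +oo[%classic = mu [set: R] - cdfm mu x.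
Proof.
move=> mu0 x0; apply/esym.
have -> : [set: R] = `]-oo, 0%R[ `|` `[0%R, x] `|` `]x, +oo[.
  apply/esym/seteqP; split => // t _ /=; rewrite !in_itv/= andbT.
  by case: (ltP t 0%R) => t0; [left; left|case: (leP t x) => tx; [left; right|right]].
rewrite measureU//; last 2 first.
- exact: measurableU.
- apply/seteqP; split => // t /= []; rewrite !in_itv/= andbT => -[t0|/andP[_ tx]].
    by rewrite ltNge (le_trans (ltW t0) x0).
  by rewrite ltNge tx.
rewrite measureU//; last first.
  by apply/seteqP; split => // t /= []; rewrite !in_itv/= leNgt => ->.
by rewrite [X in X + _ + _ - _]mu0 add0e addeAC subee ?add0e// fin_num_measure.
Qed.

(** Right continuity of the tail: [`]x, +oo[] is the increasing union of the
    rays [`]x + 1/(k+1), +oo[]. *)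
Lemma survival_right_gap (R : realType) (mu : finite_borel_measure R) (x : R)
    (l : \bar R) : l < mu `]x, +oo[%classic ->
  exists2 y, (x < y)%R & l < mu `]y, +oo[%classic.
Proof.
move=> lx; apply: contrapT => nex; move: lx; apply/negP; rewrite -leNgt.
have cv : mu `](x + k.+1%:R^-1)%R, +oo[%classic @[k --> \oo] --> mu `]x, +oo[%classic.
  have <- : \bigcup_k `](x + k.+1%:R^-1)%R, +oo[%classic = `]x, +oo[%classic.
    apply/seteqP; split => t /=.
      by move=> [k _] /=; rewrite !in_itv/= !andbT; apply: lt_trans; rewrite ltrDl.
    rewrite in_itv/= andbT => xt.
    have tx0 : (0 < t - x)%R by rewrite subr_gt0.
    have [k _ /(_ k (leqnn k))/= kt] := near_infty_natSinv_lt (PosNum tx0).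
    by exists k => //=; rewrite in_itv/= andbT -ltrBrDl.
  apply: nondecreasing_cvg_mu => //; first exact: bigcup_measurable.
  move=> m k mk; apply/subsetPset; apply: subset_itvr.
  by rewrite bnd_simp lerD2l lef_pV2 ?posrE// ler_nat.
rewrite -(cvg_lim _ cv)//; apply: lime_le; first by apply/cvg_ex; eexists; exact: cv.
apply: nearW => k; rewrite leNgt; apply/negP => lk; apply: nex.
by exists (x + k.+1%:R^-1)%R => //; rewrite ltrDl.
Qed.

(** Integrated form of a comparison of tails beyond [x0].  Below [x0] nothing
    relates the two tails, and the total mass of [mu1] bounds the deficit there;
    the uniform gap [d] on [`[x0, x1[] is what makes up for it. *)
Lemma smoment_gap (R : realType) (mu1 mu2 : finite_borel_measure R)
    (x0 x1 d : R) (n : nat) :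
  (0 <= x0)%R -> (x0 <= x1)%R -> (0 <= d)%R -> (0 < n)%N ->
  (forall x, (x0 <= x)%R -> mu1 `]x, +oo[%classic <= mu2 `]x, +oo[%classic) ->
  (forall x, (x0 <= x < x1)%R ->
     mu1 `]x, +oo[%classic + d%:E <= mu2 `]x, +oo[%classic) ->
  smoment mu1 n + (d * (x1 ^+ n - x0 ^+ n))%:E <=
  smoment mu2 n + (fine (mu1 [set: R]) * x0 ^+ n)%:E.
Proof.
move=> x00 x01 d0 n0 le12 gap.
pose M := fine (mu1 [set: R]).
have M0 : (0 <= M)%R by rewrite fine_ge0.
have x10 : (0 <= x1)%R by exact: le_trans x01.
have x0n : (0 <= x0 ^+ n)%R by rewrite exprn_ge0.
have x01n : (x0 ^+ n <= x1 ^+ n)%R by rewrite lerXn2r.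
pose I : set (measurableTypeR R) := `[0%R, +oo[%classic.
pose h (mu : finite_borel_measure R) r : \bar R :=
  mu `](r `^ n%:R^-1)%R, +oo[%classic.
have mI : measurable I by exact: measurable_itv.
have mh mu : measurable_fun I (h mu).
  have mg := @measurable_superlevel_measure _ _ _ mu idfun (@measurable_id _ _ setT).
  rewrite (_ : h mu = (fun r => mu [set x | (r < x)%R]) \o (fun r => r `^ n%:R^-1)%R).
    apply: (measurableT_comp mg); apply: measurable_funTS; exact: measurable_powR.
  by apply/funext => r; rewrite /h/= set_itvoy.
have int_step (c a b : R) : (0 <= c)%R -> (0 <= a)%R -> (a <= b)%R ->
    \int[@lebesgue_measure R]_(r in I) (c * \1_(`[a, b[%classic : set R) r)%:E
    = (c * (b - a))%:E.
  move=> c0 a0 ab; under eq_integral do rewrite EFinM.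
  rewrite ge0_integralZl_EFin//; last first.
    by apply/measurable_EFinP; exact: measurable_indic.
  rewrite integral_indic// setIidl; last first.
    by move=> r /=; rewrite /I/= !in_itv/= andbT => /andP[/(le_trans a0)].
  rewrite [X in _ * X]lebesgue_measure_itv/= lte_fin EFinM; congr (_ * _).
  case: ltP => // ba; have -> : a = b by apply/le_anti; rewrite ab.
  by rewrite subrr.
have mstep (c a b : R) :
    measurable_fun I (fun r => (c * \1_(`[a, b[%classic : set R) r)%:E).
  apply/measurable_EFinP; apply: measurable_funM => //; exact: measurable_indic.
(* Both correction terms are integrals of step functions of the level r, so the
   claim reduces to a pointwise inequality under the integral sign. *)
rewrite !smoment_layer_cake// -/I -/(h mu1) -/(h mu2) -/M.
rewrite -{1}(int_step d (x0 ^+ n)%R (x1 ^+ n)%R)//.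
rewrite -[X in (M * X)%:E]subr0 -(int_step M 0%R (x0 ^+ n)%R)//.
rewrite -!ge0_integralD//; try by [move=> r _; exact: measure_ge0|exact: mh|
  move=> r _; rewrite lee_fin mulr_ge0].
apply: ge0_le_integral => //.
- by move=> r _; rewrite adde_ge0// ?measure_ge0// lee_fin mulr_ge0.
- by apply: emeasurable_funD => //; exact: mh.
- by apply: emeasurable_funD => //; exact: mh.
move=> r; rewrite /I/= in_itv/= andbT => r0.
have rE := powR_invnXn _ _ _ r0 n0.
(* In terms of s, the n-th root of the level r, the three cases are s < x0,
   x0 <= s < x1 and x1 <= s. *)
set s := (r `^ n%:R^-1)%R in rE *.
have s0 : (0 <= s)%R by exact: powR_ge0.
have sx x : (0 <= x)%R -> (x ^+ n <= r)%R = (x <= s)%R.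
  by move=> xx; rewrite -rE ler_pXn2r.
have rx x : (0 <= x)%R -> (r < x ^+ n)%R = (s < x)%R.
  by move=> xx; rewrite -rE ltr_pXn2r.
rewrite /h -/s !indicE !mem_setE /= !in_itv/= r0/= !rx// !sx//.
case: (leP x0 s) => x0s /=; last first.
  rewrite !mulr0 !mulr1 adde0 (@le_trans _ _ (mu1 [set: R]))//.
    by apply: le_measure => //; rewrite inE.
  by rewrite addeC /M fineK ?fin_num_measure// leeDl// measure_ge0.
case: (ltP s x1) => s1 /=; rewrite !mulr0 ?mulr1 ?adde0.
  by apply: gap; rewrite x0s.
exact: le12.
Qed.

Theorem proposition7 (R : realType) (mu1 mu2 : finite_borel_measure R)
    (Dmu1 : Dco mu1) (Dmu2 : Dco mu2)
    (eq_mass : mu1 [set: R] = mu2 [set: R]) :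
  (exists x0 : R,
    [/\ (0 < x0)%R,
        cdfm mu2 x0 < cdfm mu1 x0 &
        forall x : R, (x0 <= x)%R -> cdfm mu2 x <= cdfm mu1 x]) ->
  tail_le mu1 mu2.
Proof.
move=> [x0 [x0_gt0 lt_x0 le_x]].
have [neg1 _] := Dmu1; have [neg2 _] := Dmu2.
have fin_cdf (mu : finite_borel_measure R) x : cdfm mu x \is a fin_num.
  by apply: fin_num_measure; exact: measurable_itv.
have fin_surv (mu : finite_borel_measure R) x :
    mu `]x, +oo[%classic \is a fin_num.
  by apply: fin_num_measure; exact: measurable_itv.
have le_surv x : (x0 <= x)%R -> mu1 `]x, +oo[%classic <= mu2 `]x, +oo[%classic.
  move=> x0x; have x_ge0 : (0 <= x)%R by exact: le_trans (ltW x0_gt0) x0x.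
  by rewrite !survivalE// eq_mass leeB// le_x.
have lt_surv : mu1 `]x0, +oo[%classic < mu2 `]x0, +oo[%classic.
  rewrite !survivalE ?ltW// eq_mass.
  have : mu2 [set: R] \is a fin_num by exact: fin_num_measure.
  move: lt_x0 (fin_cdf mu1 x0) (fin_cdf mu2 x0).
  case: (cdfm mu1 x0) => // a; case: (cdfm mu2 x0) => // b; case: (mu2 _) => // m.
  by rewrite -!EFinB !lte_fin ltrD2l ltrN2.
have [x1 x01 gap] := survival_right_gap _ _ _ _ lt_surv.
pose d := (fine (mu2 `]x1, +oo[%classic) - fine (mu1 `]x0, +oo[%classic))%R.
have d_gt0 : (0 < d)%R by rewrite subr_gt0 -lte_fin !fineK.
pose M := fine (mu1 [set: R]).
have M_ge0 : (0 <= M)%R by rewrite fine_ge0.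
(* M x0^n <= d (x1^n - x0^n) amounts to (1 + M / d) x0^n <= x1^n. *)
have [n0 dom] := le_exprM_near _ (1 + M / d)%R _ _ x0_gt0 x01
  (addr_ge0 ler01 (divr_ge0 M_ge0 (ltW d_gt0))).
exists (maxn 1 n0) => n; rewrite geq_max => /andP[n_gt0 /dom dom_n].
have moments := @smoment_gap R mu1 mu2 x0 x1 d n (ltW x0_gt0) (ltW x01)
  (ltW d_gt0) n_gt0 le_surv.
rewrite -(@leeD2rE _ (M * x0 ^+ n)%:E)//.
apply: le_trans (moments _).
  rewrite leeD2l// lee_fin -/M.
  have -> : (M * x0 ^+ n = d * (M / d * x0 ^+ n))%R.
    by rewrite mulrA [(d * _)%R]mulrC divfK// gt_eqF.
  by rewrite ler_pM2l// lerBrDl -[X in (X + _)%R]mul1r -mulrDl.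
move=> x /andP[x0x xx1].
rewrite /d EFinB !fineK// addeCA -[leRHS]adde0; apply: leeD.
  apply: le_measure; rewrite ?inE//; apply: subset_itvr.
  by rewrite bnd_simp ltW.
rewrite sube_le0 le_measure ?inE//; apply: subset_itvr.
by rewrite bnd_simp.
Qed.
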